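(* If $A$ is a bounded self-adjoint operator on $\mathcal{H}$ and $\mathcal{G}\subset\mathcal{H}$ is a countable set of vectors with $A^n g\ne0$ for all $g\in\mathcal{G}$ and $n\ge0$, then the system $\left\{\frac{A^n g}{\|A^n g\|}\right\}_{g\in\mathcal{G},\,n\ge0}$ is not a frame for $\mathcal{H}$.
   Context: $\mathcal{H}$ is an infinite-dimensional separable complex Hilbert space. The system is regarded as a family indexed by pairs $(g,n)$. A family $\{f_i\}_{i\in I}$ in $\mathcal{H}$ is a frame for $\mathcal{H}$ if there are $\alpha,\beta>0$ with $\alpha\|f\|^2\le\sum_{i}|\langle f,f_i\rangle|^2\le\beta\|f\|^2$ for all $f\in\mathcal{H}$. *)

(* Defs.v *)
From HB Require Import structures.
From mathcomp Require Import all_boot all_order all_algebra.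
From mathcomp Require Import all_classical all_reals all_analysis.
From mathcomp Require Import complex.

Set Implicit Arguments.
Unset Strict Implicit.
Unset Printing Implicit Defensive.

Import Order.TTheory GRing.Theory Num.Theory.
Import numFieldNormedType.Exports.

Local Open Scope classical_set_scope.
Local Open Scope ring_scope.
Local Open Scope complex_scope.

(* The norm of a normed module over [R[i]] takes its values in [R[i]]; they are
   nonnegative reals there, so that the real part loses no information. *)
Definition rnorm (R : realType) (V : normedModType R[i]) (x : V) : R :=
  complex.Re `|x|.

Definition cabs (R : realType) (z : R[i]) : R := complex.Re `|z|.

(* [dot] is linear in its first argument and conjugate-linear in the second.
   Completeness is part of [completeNormedModType]; the norm has to be the one
   induced by the inner product. *)
Definition hilbert_dot (R : realType) (H : completeNormedModType R[i])
    (dot : {dot H for Num.conj}) : Prop :=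
  forall x : H, `|x| ^+ 2 = dot x x.

Definition separable (T : topologicalType) : Prop :=
  exists2 D : set T, countable D & dense D.

Definition finite_dimensional (K : nzRingType) (V : lmodType K) : Prop :=
  exists (n : nat) (v : 'I_n -> V),
    forall x : V, exists c : 'I_n -> K, x = \sum_(i < n) c i *: v i.

Definition bounded_operator (R : realType) (V W : normedModType R[i])
    (A : {linear V -> W}) : Prop :=
  exists M : R, forall x : V, rnorm (A x) <= M * rnorm x.

Definition adjoint_of (R : realType) (H : completeNormedModType R[i])
    (dot : {dot H for Num.conj}) (A B : H -> H) : Prop :=
  forall x y : H, dot (A x) y = dot x (B y).

Definition self_adjoint (R : realType) (H : completeNormedModType R[i])
    (dot : {dot H for Num.conj}) (A : H -> H) : Prop :=
  adjoint_of dot A A.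

(* The family [F] is restricted to the index set [D]; the sum of nonnegative
   terms is taken in the extended reals. *)
Definition frame (R : realType) (H : completeNormedModType R[i])
    (dot : {dot H for Num.conj}) (I : choiceType) (D : set I) (F : I -> H) :
    Prop :=
  exists alpha beta : R, [/\ 0 < alpha, 0 < beta &
    forall f : H,
      ((alpha * rnorm f ^+ 2)%:E
         <= \esum_(i in D) (cabs (dot f (F i)) ^+ 2)%:E)%E /\
      (\esum_(i in D) (cabs (dot f (F i)) ^+ 2)%:E
         <= (beta * rnorm f ^+ 2)%:E)%E].

(* Main.v *)
Require Import Defs.
From mathcomp Require Import all_boot all_order all_algebra.
From mathcomp Require Import all_classical all_reals all_analysis.
From mathcomp Require Import complex.
From mathcomp Require Import lra.
Import Order.TTheory GRing.Theory Num.Theory.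
Import numFieldNormedType.Exports.
Local Open Scope classical_set_scope.
Local Open Scope ring_scope.
Local Open Scope complex_scope.

(** The upper frame bound alone is impossible as soon as [G] has an element
    [g]: the normalized orbit of [g] clusters too much.  Let [a n] be the norm
    of [A^n g].  Self-adjointness gives
    [<A^n g, A^(n+2j) g> = a (n+j) ^+ 2], so by Cauchy-Schwarz (for [j = 1]) the
    positive sequence [a] is log-convex: the ratios [a (n+1) / a n] are
    nondecreasing.  They are bounded because [A] is, hence they converge to a
    positive limit, and for [n] large [a n, a (n+1), ..., a (n+2K)] is almost
    a geometric progression ([logconvex_almost_geometric]).  The inner product
    of the normalized vectors of indices [n] and [n+2j], which is
    [a (n+j) ^+ 2 / (a n * a (n+2j))], is then at least [1/2] for all
    [j <= K].  Testing the upper bound [beta] on the unit vector of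
    index [n] gives [K / 4 <= beta] for every [K], which is absurd.

    If [G] is empty the lower bound fails, since the space is not zero. *)

(** Bernoulli's inequality. *)
Lemma ge1MB_expr (R : realDomainType) (e : R) (n : nat) :
  0 <= e -> e <= 1 -> 1 - n%:R * e <= (1 - e) ^+ n.
Proof.
move=> e0 e1; elim: n => [|n IH]; first by rewrite expr0 mul0r subr0.
have n0 : (0 : R) <= n%:R by rewrite ler0n.
by rewrite exprS -natr1; nra.
Qed.

(** If all the ratios of [a] from the index [n] on lie between [t] and [s], then
    [a n * a (n + 2j)] exceeds [a (n + j) ^+ 2] by a factor of at most
    [(s / t) ^+ 2j] (multiplied out, so that [t = 0] is harmless). *)
Lemma ratio_bounds_expr (R : realDomainType) (a : nat -> R) (s t : R)
    (n : nat) :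
  (forall m, 0 < a m) -> 0 <= t ->
  (forall m, (n <= m)%N -> t * a m <= a m.+1 <= s * a m) ->
  forall j, t ^+ j.*2 * (a n * a (n + j.*2)%N) <=
            s ^+ j.*2 * a (n + j)%N ^+ 2.
Proof.
move=> a_gt0 t0 ats; elim=> [|j IH].
  by rewrite double0 !expr0 !addn0.
rewrite doubleS !addnS.
have /andP[_ u1] := ats (n + j.*2)%N (leq_addr _ _).
have /andP[_ u2] := ats (n + j.*2).+1 (leqW (leq_addr _ _)).
have /andP[l1 _] := ats (n + j)%N (leq_addr _ _).
have b0 := a_gt0 (n + j.*2)%N; have b1 := a_gt0 (n + j.*2).+1.
have s0 : 0 <= s.
  by rewrite -(pmulr_lge0 _ b0); apply: le_trans u1; exact: ltW.
have up : a (n + j.*2).+2 <= s ^+ 2 * a (n + j.*2)%N.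
  by apply: le_trans u2 _; rewrite expr2 -mulrA ler_wpM2l.
have lo : t ^+ 2 * a (n + j)%N ^+ 2 <= a (n + j).+1 ^+ 2.
  by rewrite -exprMn lerXn2r// nnegrE ?mulr_ge0// ltW.
have expSS (x : R) : x ^+ j.*2.+2 = x ^+ 2 * x ^+ j.*2 by rewrite -exprD.
rewrite !expSS.
apply: (@le_trans _ _
    (t ^+ 2 * s ^+ 2 * (t ^+ j.*2 * (a n * a (n + j.*2)%N)))).
  have w0 : 0 <= t ^+ 2 * t ^+ j.*2 * a n.
    by rewrite mulr_ge0 ?mulr_ge0 ?exprn_ge0// ltW.
  by have := ler_wpM2l w0 up; lra.
apply: le_trans (ler_wpM2l (mulr_ge0 (sqr_ge0 t) (sqr_ge0 s)) IH) _.
by have := ler_wpM2l (mulr_ge0 (sqr_ge0 s) (exprn_ge0 j.*2 s0)) lo; lra.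
Qed.

(** By log-convexity [a (n + j) ^+ 2 <= a n * a (n + 2j)], with equality for a
    geometric progression.  When the ratios are bounded the converse inequality
    holds up to a factor of [2] on arbitrarily long stretches: it suffices that
    [a n.+1 / a n] be close enough to the supremum of all the ratios. *)
Lemma logconvex_almost_geometric {R : realType} {a : nat -> R} {M : R} :
  (forall n, 0 < a n) ->
  (forall n, a n.+1 ^+ 2 <= a n * a n.+2) ->
  (forall n, a n.+1 <= M * a n) ->
  forall K : nat, exists n : nat, forall j : nat, (j <= K)%N ->
    a n * a (n + j.*2)%N <= 2 * a (n + j)%N ^+ 2.
Proof.
move=> a_gt0 a_lc a_le K.
pose r n := a n.+1 / a n.
have r_gt0 n : 0 < r n by rewrite divr_gt0.
have r_nd : {homo r : m n / (m <= n)%N >-> m <= n}.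
  apply: homo_leq => // [|n]; first exact: le_trans.
  by rewrite /r ler_pdivrMr// mulrAC ler_pdivlMr// -expr2 mulrC.
have r_sup : has_sup (range r).
  split; first by exists (r 0%N), 0%N.
  by exists M => _ [n _ <-]; rewrite /r ler_pdivrMr.
set s := sup (range r).
have r_le n : r n <= s by apply: (sup_upper_bound r_sup); exists n.
have s_gt0 : 0 < s by apply: lt_le_trans (r_le 0%N).
(* With [r n >= (1 - e) * s], the factor [(1 - e) ^+ 2j] is at least
   [1 - 2K * e], so [e <= 1 / (4K)] makes it at least [1/2]. *)
pose e : R := (K.*2.*2.+1)%:R^-1.
have e_gt0 : 0 < e by rewrite invr_gt0 ltr0n.
have [_ [n _ <-] r_adh] := sup_adherent (mulr_gt0 s_gt0 e_gt0) r_sup.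
exists n => j jK.
have e_le1 : e <= 1 by rewrite invf_le1 ?ler1n ?ltr0n.
have q_ge : (1 - e) * s <= r n by rewrite mulrBl mul1r mulrC; exact: ltW.
have q0 : 0 <= 1 - e by rewrite subr_ge0.
have qs0 : 0 <= (1 - e) * s by rewrite mulr_ge0// ltW.
have bnd m : (n <= m)%N -> (1 - e) * s * a m <= a m.+1 <= s * a m.
  move=> nm; apply/andP; split; last by rewrite -ler_pdivrMr//; exact: r_le.
  by rewrite -ler_pdivlMr//; apply: le_trans q_ge _; exact: r_nd.
have := @ratio_bounds_expr R a s ((1 - e) * s) n a_gt0 qs0 bnd j.
rewrite exprMn mulrAC mulrC ler_pM2l ?exprn_gt0// => main.
have half : 2^-1 <= (1 - e) ^+ j.*2.
  apply: le_trans (@ge1MB_expr R e j.*2 (ltW e_gt0) e_le1).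
  have : j.*2.*2%:R * e <= 1.
    by rewrite /e ler_pdivrMr ?ltr0n// mul1r ler_nat ltnW// ltnS !leq_double.
  rewrite -(muln2 j.*2) natrM; lra.
have p0 : 0 <= a n * a (n + j.*2)%N by rewrite mulr_ge0 ?ltW.
by have := ler_wpM2l p0 half; lra.
Qed.

Lemma esum_ge_mulrn {R : realType} {T : choiceType} {D : set T}
    {f : T -> R} (h : nat -> T) {c : R} {K : nat} :
  injective h -> (forall j, D (h j)) ->
  (forall j, (j < K)%N -> c <= f (h j)) ->
  ((c *+ K)%:E <= \esum_(i in D) (f i)%:E)%E.
Proof.
move=> h_inj Dh cf; apply: esum_ge.
exists [set` [seq h j | j <- iota 0 K]].
  split; first exact: finite_seq.
  by move=> x /mapP[j _ ->].
rewrite -fsbig_seq ?map_inj_uniq ?iota_uniq// big_map sumEFin lee_fin.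
rewrite -{1}(size_iota 0 K) -sum1_size -sumrMnr big_seq [leRHS]big_seq.
by apply: ler_sum => j; rewrite mem_iota => /andP[_ jK]; exact: cf.
Qed.

Lemma conj_realC (R : realType) (r : R) : Num.conj r%:C = r%:C.
Proof. by apply: conj_Creal; rewrite complex_real. Qed.

Lemma norm_realC (R : realType) (r : R) : 0 <= r -> `|r%:C| = r%:C :> R[i].
Proof. by move=> r0; rewrite ger0_norm// ler0c. Qed.

Lemma normE_rnorm {R : realType} {V : normedModType R[i]} (x : V) :
  `|x| = (rnorm x)%:C.
Proof. by rewrite /rnorm RRe_real// ger0_real. Qed.

Lemma rnorm_gt0 {R : realType} {V : normedModType R[i]} (x : V) :
  x != 0 -> 0 < rnorm x.
Proof. by move=> x0; rewrite -ltcR -normE_rnorm normr_gt0. Qed.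

Lemma rnorm_normalized {R : realType} {V : normedModType R[i]} (x : V) :
  x != 0 -> rnorm (`|x|^-1 *: x) = 1.
Proof.
move=> x0; apply: complexI; rewrite -normE_rnorm normrZ normfV normr_id.
by rewrite mulVf// normr_eq0.
Qed.

(** The Cauchy-Schwarz inequality, in the only case needed: a real inner
    product. *)
Lemma dot_real_le {R : realType} {H : completeNormedModType R[i]}
    {dot : {dot H for Num.conj}} (dotE : hilbert_dot dot) (x y : H) (c : R) :
  x != 0 -> y != 0 -> dot x y = c%:C -> c <= rnorm x * rnorm y.
Proof.
move=> /rnorm_gt0 a0 /rnorm_gt0 b0 xyc.
set a := rnorm x in a0 *; set b := rnorm y in b0 *.
have dotZ : dot (b%:C *: x) (a%:C *: y) = (b * (a * c))%:C.
  by rewrite linearZl_LR linearZr_LR/= xyc conj_realC !rmorphM.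
(* The squared norm of [b *: x - a *: y] is [2 * a * b * (a * b - c)]. *)
have := dnorm_ge0 dot (b%:C *: x - a%:C *: y).
rewrite dnormB !dnormZ -!dotE (norm_realC _ _ (ltW a0)).
rewrite (norm_realC _ _ (ltW b0)) !normE_rnorm dotZ conj_realC -/a -/b.
rewrite -!rmorphXn -!rmorphM -!rmorphD -!rmorphB ler0c => le0.
have ab0 : 0 < a * b by rewrite mulr_gt0.
by rewrite -(ler_pM2l ab0); nra.
Qed.

Lemma cabs_dot_normalized {R : realType} {H : completeNormedModType R[i]}
    (dot : {dot H for Num.conj}) (x y : H) (c : R) :
  0 <= c -> dot x y = c%:C ->
  cabs (dot (`|x|^-1 *: x) (`|y|^-1 *: y)) = c / (rnorm x * rnorm y).
Proof.
move=> c0 xyc; rewrite linearZl_LR linearZr_LR/= xyc.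
rewrite (normE_rnorm x) (normE_rnorm y).
have r0 : 0 <= (rnorm x)^-1 * ((rnorm y)^-1 * c).
  by rewrite !mulr_ge0 ?invr_ge0// -ler0c -normE_rnorm.
rewrite -!fmorphV conj_realC -!rmorphM /cabs norm_realC//=.
by rewrite mulrA -invfM mulrC.
Qed.

Lemma dot_iterC {R : realType} {H : completeNormedModType R[i]}
    {dot : {dot H for Num.conj}} {A : H -> H} :
  self_adjoint dot A -> forall (m n k : nat) (g : H),
  dot (iter (m + k) A g) (iter n A g) = dot (iter m A g) (iter (n + k) A g).
Proof.
move=> sa m n k g; elim: k n => [|k IH] n; first by rewrite !addn0.
by rewrite addnS iterS sa -iterS IH addSnnS.
Qed.

(** The inner product of [A^n g] and [A^(n+2k) g] is the squared norm of the
    iterate halfway between them. *)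
Lemma dot_iterDD {R : realType} {H : completeNormedModType R[i]}
    {dot : {dot H for Num.conj}} {A : H -> H} :
  hilbert_dot dot -> self_adjoint dot A -> forall (n k : nat) (g : H),
  dot (iter n A g) (iter (n + k.*2) A g) = (rnorm (iter (n + k) A g) ^+ 2)%:C.
Proof.
move=> dotE sa n k g.
by rewrite -addnn addnA -dot_iterC// -dotE normE_rnorm rmorphXn.
Qed.

Theorem theorem6p2 (R : realType) (H : completeNormedModType R[i])
    (dot : {dot H for Num.conj}) (A : {linear H -> H}) (G : set H) :
  hilbert_dot dot ->
  separable H ->
  ~ finite_dimensional H ->
  bounded_operator A ->
  self_adjoint dot A ->
  countable G ->
  (forall (g : H) (n : nat), G g -> iter n A g <> 0) ->
  ~ frame dot (G `*` [set: nat])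
      (fun p : H * nat => `|iter p.2 A p.1|^-1 *: iter p.2 A p.1).
Proof.
move=> dotE _ Hinf [M A_le] sa _ G_neq0 [alpha [beta [alpha0 beta0 fr]]].
have [x x0] : exists x : H, x != 0.
  apply: contrapT => H0; apply: Hinf; exists 0%N, (fun=> 0) => x.
  exists (fun=> 0); rewrite big_ord0.
  by apply: contrapT => /eqP x0; apply: H0; exists x.
have [G0|/set0P[g Gg]] := eqVneq G set0.
  have [+ _] := fr x.
  rewrite G0 set0X esum_set0 lee_fin leNgt mulr_gt0// exprn_gt0//.
  exact: rnorm_gt0.
pose a n := rnorm (iter n A g).
have a_gt0 n : 0 < a n by apply: rnorm_gt0; apply/eqP; exact: G_neq0.
have a_lc n : a n.+1 ^+ 2 <= a n * a n.+2.
  apply: (dot_real_le dotE); [exact/eqP/G_neq0..|].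
  by have := dot_iterDD dotE sa n 1 g; rewrite addn1 addn2.
have a_le n : a n.+1 <= M * a n by exact: A_le.
have [K betaK] : exists K : nat, beta < 4^-1 *+ K.
  exists (Num.bound (4 * beta)).
  have := archi_boundP (mulr_ge0 (ler0n R 4) (ltW beta0)).
  rewrite -mulr_natr; lra.
have [n n_half] := logconvex_almost_geometric a_gt0 a_lc a_le K.
pose e (p : H * nat) := `|iter p.2 A p.1|^-1 *: iter p.2 A p.1.
have [_ up] := fr (e (g, n)).
have h_inj : injective (fun j => (g, (n + j.*2)%N)).
  by move=> i j [] /addnI /double_inj.
have c_ge j : (j < K)%N ->
    4^-1 <= cabs (dot (e (g, n)) (e (g, (n + j.*2)%N))) ^+ 2.
  move=> jK.
  have nonneg := sqr_ge0 (rnorm (iter (n + j) A g)).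
  rewrite /e/= (cabs_dot_normalized _ _ _ _ nonneg (dot_iterDD dotE sa n j g)).
  rewrite -!/(a _).
  have : 2^-1 <= a (n + j)%N ^+ 2 / (a n * a (n + j.*2)%N).
    rewrite ler_pdivlMr ?mulr_gt0//.
    have := n_half _ (ltnW jK); lra.
  nra.
have index_mem j : (G `*` [set: nat]) (g, (n + j.*2)%N) by split.
have := esum_ge_mulrn (f := fun p => cabs (dot (e (g, n)) (e p)) ^+ 2)
  _ h_inj index_mem c_ge.
move=> /le_trans /(_ up).
rewrite rnorm_normalized; last by apply/eqP; exact: G_neq0.
by rewrite expr1n mulr1 lee_fin leNgt betaK.
Qed.
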